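(* Let $(\mathcal X,\mathcal A,c,d,P,x_0,d_0)$ be a finite transient constrained Markov decision process (CMDP), let $\pi_B\in\Delta$ be a feasible baseline policy, let $\pi^*$ be an optimal policy of problem $\mathcal{OPT}$, and let $\epsilon^*$, $L_{\epsilon^*}$ and the safe Bellman operator $T$ be built from $\pi_B$ and $\pi^*$ as in the context. Suppose $\pi_B$ satisfies $$\max_{x\in\mathcal X'}\epsilon^*(x)\le D_{\max}\cdot\min\left\{\frac{d_0-\mathcal D_{\pi_B}(x_0)}{\overline{\mathrm T}D_{\max}},\ \frac{\overline{\mathrm T}D_{\max}-\overline{\mathcal D}}{\overline{\mathrm T}D_{\max}+\overline{\mathcal D}}\right\},\qquad \overline{\mathcal D}=\max_{x\in\mathcal X'}\max_{\pi\in\Delta}\mathcal D_\pi(x).$$ Let $V^*:\mathcal X\to\mathbb R$ be the unique solution of the fixed-point equation $T[V](x)=V(x)$, $\forall x\in\mathcal X$. Then $V^*(x_0)$ equals the optimal value of problem $\mathcal{OPT}$, i.e. $V^*(x_0)=\min_{\pi\in\Delta}\{\mathcal C_\pi(x_0):\mathcal D_\pi(x_0)\le d_0\}$. Furthermore, an optimal policy of $\mathcal{OPT}$ can be constructed greedily: a policy $\bar\pi$ with $$\bar\pi(\cdot|x)\in\arg\min_{\pi\in\mathcal F_{L_{\epsilon^*}}(x)}T_{\pi,c}[V^*](x),\qquad\forall x\in\mathcal X',$$ is an optimal policy of $\mathcal{OPT}$.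
   Context: CMDP. $\mathcal X=\mathcal X'\cup\{x_{\text{Term}}\}$ is a finite state space with transient states $\mathcal X'$ and a terminal state $x_{\text{Term}}\notin\mathcal X'$; $\mathcal A$ is a finite action set; $c(x,a)\in[0,C_{\max}]$ is the immediate cost; $d(x)\in[0,D_{\max}]$ is the immediate constraint cost, with $D_{\max}>0$; $P(\cdot|x,a)$ is the transition probability; $x_0\in\mathcal X'$ is the initial state; $d_0\ge 0$ is the constraint threshold. $\Delta$ is the set of Markov stationary (randomized) policies and $\Delta(x)$ the set of probability distributions $\pi(\cdot|x)$ on $\mathcal A$. $\mathrm T^*$ is the first hitting time of $x_{\text{Term}}$. Standing assumption (transience): $\mathrm T^*\le\overline{\mathrm T}$ for a constant $\overline{\mathrm T}$, uniformly over policies and initial states. Value functions and problem. $\mathcal C_\pi(x)=\mathbb E[\sum_{t=0}^{\mathrm T^*-1}c(x_t,a_t)\mid x_0=x,\pi]$ and $\mathcal D_\pi(x)=\mathbb E[\sum_{t=0}^{\mathrm T^*-1}d(x_t)\mid x_0=x,\pi]$. Problem $\mathcal{OPT}$: $\min_{\pi\in\Delta}\{\mathcal C_\pi(x_0):\mathcal D_\pi(x_0)\le d_0\}$. A policy is feasible if $\mathcal D_\pi(x_0)\le d_0$, and $\pi^*$ denotes an optimal policy in $\Delta$. Bellman operator. For $\pi\in\Delta$, a cost function $h$ and $x\in\mathcal X'$: $T_{\pi,h}[V](x)=\sum_a\pi(a|x)\big[h(x,a)+\sum_{x'\in\mathcal X'}P(x'|x,a)V(x')\big]$ (a cost depending only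 on $x$ is viewed as a function of $(x,a)$). Lyapunov candidate. $D_{TV}(\pi^*\|\pi_B)(x)=\frac12\sum_{a}|\pi_B(a|x)-\pi^*(a|x)|$; $\epsilon^*(x)=2\overline{\mathrm T}D_{\max}D_{TV}(\pi^*\|\pi_B)(x)$ for $x\in\mathcal X'$; $L_{\epsilon^*}(x)=\mathbb E[\sum_{t=0}^{\mathrm T^*-1}(d(x_t)+\epsilon^*(x_t))\mid x_0=x,\pi_B]$ for $x\in\mathcal X'$, and $L_{\epsilon^*}(x_{\text{Term}})=0$. Induced policies. For $L:\mathcal X\to\mathbb R_{\ge0}$ and $x\in\mathcal X'$: $\mathcal F_L(x)=\{\pi(\cdot|x)\in\Delta(x):T_{\pi,d}[L](x)\le L(x)\}$. Safe Bellman operator. $T[V](x)=\min_{\pi\in\mathcal F_{L_{\epsilon^*}}(x)}T_{\pi,c}[V](x)$ if $x\in\mathcal X'$, and $T[V](x)=0$ otherwise. It is a monotone contraction (in a weighted sup-norm), so its fixed point is unique. *)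

(* Defs.v *)
From HB Require Import structures.
From mathcomp Require Import all_boot all_order all_algebra.
From mathcomp Require Import all_classical all_reals all_analysis.
Set Implicit Arguments.
Unset Strict Implicit.
Unset Printing Implicit Defensive.
Import Order.TTheory GRing.Theory Num.Theory.
Local Open Scope classical_set_scope.
Local Open Scope ring_scope.

(* The transient states X' form the finite type [S], and the state space is
   X = [option S], where [None] is the terminal state x_Term. Costs, transition
   probabilities and policies are only ever used before the hitting time of
   x_Term, so they are indexed by [S]. *)
Record cmdp (R : realType) (S A : finType) := Cmdp {
  cost : S -> A -> R;
  ccost : S -> R;
  trans : S -> A -> option S -> R;
  init : S;
  threshold : R;
  Cmax : R;
  Dmax : R;
  cost_bounds : forall x a, 0 <= cost x a <= Cmax;
  ccost_bounds : forall x, 0 <= ccost x <= Dmax;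
  Dmax_gt0 : 0 < Dmax;
  trans_ge0 : forall x a y, 0 <= trans x a y;
  trans_sum1 : forall x a, \sum_(y : option S) trans x a y = 1;
  threshold_ge0 : 0 <= threshold }.

Definition is_dist (R : realType) (A : finType) (p : A -> R) : Prop :=
  (forall a, 0 <= p a) /\ \sum_(a : A) p a = 1.

Definition is_policy (R : realType) (S A : finType) (pi : S -> A -> R) : Prop :=
  forall x, is_dist (pi x).

(* An episode [:: (x_0, a_0); ...; (x_{n-1}, a_{n-1})] is a trajectory stopped
   when it first hits x_Term, which happens at time n: a sample point of the
   event {T* < oo}. *)
Definition episode (S A : finType) := seq (S * A).

Definition hitting_time (S A : finType) (w : episode S A) : nat := size w.

(* x_t, equal to x_Term as soon as t >= T*. *)
Definition state_at (S A : finType) (w : episode S A) (t : nat) : option S :=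
  omap fst (onth w t).

Section Model.
Variables (R : realType) (S A : finType) (M : cmdp R S A).
Implicit Types (pi : S -> A -> R) (x : S) (w : episode S A) (h : S -> A -> R).

Definition episode_prob pi x w : R :=
  (state_at w 0 == Some x)%:R *
  \prod_(t < hitting_time w)
     (let: (y, a) := tnth (in_tuple w) t in
      pi y a * trans M y a (state_at w t.+1)).

(* Episodes form a countable set, so their law, given x_0 = x and pi, is
   discrete; all events and nonnegative random variables are handled by
   unordered sums in [0, +oo]. *)
Definition episode_Pr pi x (E : set (episode S A)) : \bar R :=
  (\esum_(w in E) (episode_prob pi x w)%:E)%E.

Definition episode_E pi x (f : episode S A -> R) : \bar R :=
  (\esum_(w in [set: episode S A]) (episode_prob pi x w * f w)%:E)%E.

(* T* <= Tbar almost surely. Episodes carry only the mass of {T* < oo}, so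
   total mass 1 on {T* <= Tbar} also excludes nontermination. *)
Definition transient (Tbar : R) : Prop :=
  forall pi x, is_policy pi ->
    episode_Pr pi x [set w | (hitting_time w)%:R <= Tbar] = 1%E.

(* E[sum_{t < T*} h(x_t, a_t) | x_0 = x, pi]; finite under transience. *)
Definition value pi h x : R :=
  fine (episode_E pi x (fun w => \sum_(z <- w) h z.1 z.2)).

Definition cost_value pi x : R := value pi (cost M) x.

Definition ccost_value pi x : R := value pi (fun y _ => ccost M y) x.

Definition feasible pi : Prop :=
  is_policy pi /\ ccost_value pi (init M) <= threshold M.

Definition optimal pi : Prop :=
  feasible pi /\
  forall pi', feasible pi' -> cost_value pi (init M) <= cost_value pi' (init M).

(* T_{pi,h}[V](x), where p stands for pi(.|x). *)
Definition bellman (p : A -> R) h (V : option S -> R) x : R :=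
  \sum_(a : A) p a * (h x a + \sum_(y : S) trans M x a (Some y) * V (Some y)).

Definition dTV (p q : A -> R) : R := 2^-1 * \sum_(a : A) `|q a - p a|.

Definition eps_star (Tbar : R) (pistar piB : S -> A -> R) x : R :=
  2 * Tbar * Dmax M * dTV (pistar x) (piB x).

Definition lyapunov (Tbar : R) (pistar piB : S -> A -> R) (z : option S) : R :=
  if z is Some x
  then value piB (fun y _ => ccost M y + eps_star Tbar pistar piB y) x
  else 0.

(* F_L(x) *)
Definition induced (L : option S -> R) x : set (A -> R) :=
  [set p | is_dist p /\ bellman p (fun y _ => ccost M y) L x <= L (Some x)].

(* The infimum is a minimum when F_L(x) is nonempty: it is that of a linear
   form over a compact polytope. *)
Definition safe_bellman (L V : option S -> R) (z : option S) : R :=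
  if z is Some x
  then inf [set bellman p (cost M) V x | p in induced L x]
  else 0.

Definition greedy (L V : option S -> R) pi : Prop :=
  forall x, induced L x (pi x) /\
    forall p, induced L x p ->
      bellman (pi x) (cost M) V x <= bellman p (cost M) V x.

Definition max_state (f : S -> R) : R :=
  \big[Num.max/f (init M)]_(x : S) f x.

(* max_x max_pi D_pi(x); under transience the supremum over pi is attained, by
   a deterministic policy. *)
Definition Dbar : R :=
  max_state (fun x => sup [set ccost_value pi x | pi in [set pi | is_policy pi]]).

End Model.

Definition is_min (R : realType) (E : set R) (m : R) : Prop :=
  E m /\ lbound E m.

(* Main.v *)
(* Uniform transience makes the transition graph acyclic: running the uniform
   policy, which charges every edge, gives each state x a rank rk x <= Tbar that
   strictly decreases along transitions. Hence values are finite sums, Bellman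
   sub- and supersolutions are compared by induction on the rank, and the
   safe Bellman operator, whose value at x only involves states of smaller rank,
   has exactly one fixed point.

   The bound on eps* has two uses. Its second term gives L <= Tbar Dmax, so that
   replacing piB by pi* in the Bellman equation of L costs at most
   2 dTV Tbar Dmax = eps*, i.e. pi* is L-induced; hence V(x_0) <= C_{pi*}(x_0).
   Its first term gives L(x_0) <= d_0; as L is a supersolution of the constraint
   Bellman equation of any L-induced policy, such policies are feasible. A greedy
   policy, which exists by compactness of F_L(x), therefore is feasible with
   cost V(x_0). *)
Require Import Defs.
From mathcomp Require Import all_boot all_order all_algebra.
From mathcomp Require Import all_classical all_reals all_analysis.
From mathcomp Require Import ring lra.
Set Implicit Arguments.
Unset Strict Implicit.
Unset Printing Implicit Defensive.
Import Order.TTheory GRing.Theory Num.Theory numFieldNormedType.Exports.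
Local Open Scope classical_set_scope.
Local Open Scope ring_scope.

(** * Linear programs over distributions with one linear constraint *)

Lemma continuous_lincomb (R : realType) (T : topologicalType) (A : finType)
    (g : A -> T -> R) (f : A -> R) :
  (forall a, continuous (g a)) -> continuous (fun x => \sum_a g a x * f a).
Proof.
move=> gc.
have Gc (a : A) : continuous (fun x => g a x * f a).
  by move=> x; apply: cvgM; [exact: gc|exact: cvg_cst].
have C : continuous (fun z : R * R => z.1 + z.2).
  by move=> z; apply: cvgD; [exact: cvg_fst|exact: cvg_snd].
exact: (@continuous_big R A +%R 0 xpredT C T (index_enum A)
  (fun a x => g a x * f a)).
Qed.

Lemma linear_form_continuous (R : realType) (A : finType) (f : A -> R) :
  continuous (fun p : prod_topology (fun _ : A => R) => \sum_a p a * f a : R).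
Proof.
exact: (@continuous_lincomb R (prod_topology (fun _ : A => R)) A
  (fun a p => p a) f (@proj_continuous A (fun _ => R))).
Qed.

(** The constraint set is closed in the cube [[0, 1]^A], which is compact by Tychonoff, so the
    continuous linear form attains its minimum. The set of induced distributions at a state has
    exactly this shape. *)
Lemma simplex_halfspace_argmin (R : realType) (A : finType)
    (f g : A -> R) (b : R) :
  (exists p, is_dist p /\ \sum_a p a * g a <= b) ->
  exists p, [/\ is_dist p, \sum_a p a * g a <= b &
    forall q, is_dist q -> \sum_a q a * g a <= b ->
      \sum_a p a * f a <= \sum_a q a * f a].
Proof.
move=> [p0 [dp0 p0b]].
pose K := [set p : prod_topology (fun _ : A => R) |
  is_dist p /\ \sum_a p a * g a <= b].
have cK : compact K.
  apply: (@subclosed_compact _ _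
    [set p : prod_topology (fun _ : A => R) | forall a, `[0, 1]%classic (p a)]).
  - have -> : K = (\bigcap_(a in [set: A])
          ((fun p : prod_topology (fun _ : A => R) => p a)
             @^-1` [set t | 0 <= t])) `&`
        ((fun p : prod_topology (fun _ : A => R) => \sum_a p a * 1)
           @^-1` [set 1 : R]) `&`
        ((fun p : prod_topology (fun _ : A => R) => \sum_a p a * g a)
           @^-1` [set t | t <= b]).
      apply/seteqP; split=> p /=.
      + case=> -[pge0 p1] pb; split=> //; split=> [a _|]; first exact: pge0.
        by rewrite -[RHS]p1; apply: eq_bigr => a _; rewrite mulr1.
      + case=> -[pge0 p1] pb; split=> //; split=> [a|]; first exact: pge0.
        by rewrite -[RHS]p1; apply: eq_bigr => a _; rewrite mulr1.
    apply: closedI; first apply: closedI.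
    + apply: closed_bigI => a _; apply: preimage_closed; last exact: closed_ge.
      by move=> p _; exact: (@proj_continuous A (fun _ => R) a p).
    + apply: preimage_closed; last exact: closed_eq.
      by move=> p _; exact: linear_form_continuous.
    + apply: preimage_closed; last exact: closed_le.
      by move=> p _; exact: linear_form_continuous.
  - apply: (@tychonoff A (fun _ => R) (fun _ => `[0, 1]%classic)) => _.
    exact: segment_compact.
  - move=> p [[pge0 p1] _] a /=; rewrite in_itv /= pge0 /= -p1 (bigD1 a) //=.
    by rewrite lerDl sumr_ge0.
have [||p] := @compact_EVT_min _ R
  (fun p : prod_topology (fun _ : A => R) => \sum_a p a * f a) K _ cK.
- by exists p0.
- by apply: continuous_subspaceT; exact: linear_form_continuous.
rewrite inE => -[dp pb] pmin; exists p; split=> // q dq qb.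
by apply: pmin; rewrite inE.
Qed.

(** * Enumeration of words of bounded length *)

Section Words.
Variable T : finType.

(** All words of length at most [n], listed without repetition, so that sums over short episodes
    become finite sums with a recursion on [n]. *)
Fixpoint words n : seq (seq T) :=
  if n is n'.+1 then [::] :: [seq z :: w | z <- enum T, w <- words n']
  else [:: [::]].

Lemma mem_words n w : (w \in words n) = (size w <= n)%N.
Proof.
elim: n w => [|n IH] [|z w] //=; rewrite inE /=.
apply/allpairsP/idP => [[[z' w'] [/= _ hw' [_ ->]]]|hw].
  by rewrite ltnS -IH.
by exists (z, w); split; rewrite ?mem_enum ?IH.
Qed.

Lemma words_uniq n : uniq (words n).
Proof.
elim: n => //= n IH; apply/andP; split.
  by apply/allpairsP => -[[z w] [_ _]].
by apply: allpairs_uniq => //; [rewrite enum_uniq|case=> [a b] [c d] _ _ [-> ->]].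
Qed.

Lemma sum_wordsS (V : nmodType) n (F : seq T -> V) :
  \sum_(w <- words n.+1) F w =
  F [::] + \sum_z \sum_(w <- words n) F (z :: w).
Proof. by rewrite big_cons big_allpairs_dep big_enum. Qed.

End Words.

Lemma sum_option (V : nmodType) (T : finType) (F : option T -> V) :
  \sum_(o : option T) F o = F None + \sum_y F (Some y).
Proof.
rewrite (bigD1 None) //=; congr (_ + _).
rewrite (reindex_omap Some id) //=; last by case.
by apply: eq_bigl => y; rewrite eqxx.
Qed.

(** * Finite-horizon probabilities and expected costs of episodes *)

Section Episodes.
Variables (R : realType) (S A : finType) (M : cmdp R S A).
Implicit Types (pi : S -> A -> R) (x : S) (w : episode S A) (h : S -> A -> R).

(** The product in [episode_prob] in recursive form, without the indicator of the initial state. The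
    last transition leads to [None], since [state_at [::] 0] is [None]. *)
Fixpoint path_weight pi w : R :=
  if w is (y, a) :: w' then
    pi y a * trans M y a (state_at w' 0) * path_weight pi w'
  else 1.

Lemma episode_probE pi x w :
  episode_prob M pi x w = (state_at w 0 == Some x)%:R * path_weight pi w.
Proof.
congr (_ * _); rewrite /hitting_time; elim: w => [|[y a] w IH] /=.
  by rewrite big_ord0.
rewrite big_ord_recl /= -IH; congr (_ * _).
by apply: eq_bigr => t _; rewrite !(tnth_nth (y, a)).
Qed.

(* mass pi n (Some x) is the probability of T* <= n from x, and total h pi n
   (Some x) the expected cost on that event. *)
Definition mass pi n (o : option S) : R :=
  \sum_(w <- words (S * A)%type n) (state_at w 0 == o)%:R * path_weight pi w.

Definition total h pi n (o : option S) : R :=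
  \sum_(w <- words (S * A)%type n)
    (state_at w 0 == o)%:R * path_weight pi w * \sum_(z <- w) h z.1 z.2.

(** Words are grouped by their first state; this is conditioning on the successor state in the
    first-step recursions below. *)
Lemma sum_words_start (F : option S -> R) (G : episode S A -> R) n :
  \sum_(w <- words (S * A)%type n) F (state_at w 0) * G w =
  \sum_o F o * \sum_(w <- words (S * A)%type n) (state_at w 0 == o)%:R * G w.
Proof.
under [RHS]eq_bigr do rewrite mulr_sumr.
rewrite exchange_big /=; apply: eq_bigr => w _.
rewrite (bigD1 (state_at w 0)) //= eqxx mul1r big1 ?addr0 // => o.
by rewrite eq_sym => /negbTE ->; rewrite mul0r mulr0.
Qed.

Lemma sum_words_startS (F : S * A -> episode S A -> R) x n :
  \sum_(w <- words (S * A)%type n.+1)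
    (state_at w 0 == Some x)%:R * (if w is z :: w' then F z w' else 0) =
  \sum_a \sum_(w <- words (S * A)%type n) F (x, a) w.
Proof.
rewrite sum_wordsS mul0r add0r.
transitivity (\sum_y \sum_a \sum_(w <- words (S * A)%type n)
    (Some y == Some x)%:R * F (y, a) w).
  by rewrite pair_bigA; apply: eq_bigr => -[y a] _.
rewrite (bigD1 x) //= [X in _ + X]big1 ?addr0 => [|y yx].
  by apply: eq_bigr => a _; apply: eq_bigr => w _; rewrite eqxx mul1r.
rewrite big1 // => a _; rewrite big1 // => w _.
by rewrite (inj_eq Some_inj) (negbTE yx) mul0r.
Qed.

Lemma sum_words_None (F : episode S A -> R) n :
  \sum_(w <- words (S * A)%type n) (state_at w 0 == None)%:R * F w = F [::].
Proof.
case: n => [|n]; first by rewrite big_seq1 mul1r.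
rewrite sum_wordsS mul1r big1 ?addr0 // => z _.
by rewrite big1 // => w _; rewrite mul0r.
Qed.

Lemma mass_None pi n : mass pi n None = 1.
Proof. exact: sum_words_None. Qed.

Lemma mass0 pi x : mass pi 0 (Some x) = 0.
Proof. by rewrite /mass big_seq1 mul0r. Qed.

Lemma massS pi n x :
  mass pi n.+1 (Some x) = \sum_a pi x a * \sum_o trans M x a o * mass pi n o.
Proof.
pose F z w : R := pi z.1 z.2 * trans M z.1 z.2 (state_at w 0) * path_weight pi w.
transitivity (\sum_a \sum_(w <- words (S * A)%type n) F (x, a) w).
  rewrite -sum_words_startS; apply: eq_bigr => -[|[y a] w] _ //=.
  by rewrite !mul0r.
apply: eq_bigr => a _; rewrite -sum_words_start mulr_sumr.
by apply: eq_bigr => w _; rewrite /F mulrA.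
Qed.

(** First-step analysis. The immediate cost is counted only on episodes that end within the horizon,
    hence the factor built from [mass]. *)
Lemma totalS h pi n x :
  total h pi n.+1 (Some x) =
  \sum_a pi x a * (h x a * (\sum_o trans M x a o * mass pi n o)
    + \sum_y trans M x a (Some y) * total h pi n (Some y)).
Proof.
pose F z w : R := pi z.1 z.2 *
  (h z.1 z.2 * (trans M z.1 z.2 (state_at w 0) * path_weight pi w) +
   trans M z.1 z.2 (state_at w 0) *
     (path_weight pi w * \sum_(z <- w) h z.1 z.2)).
transitivity (\sum_a \sum_(w <- words (S * A)%type n) F (x, a) w).
  rewrite -sum_words_startS; apply: eq_bigr => -[|[y a] w] _ /=.
    by rewrite !mul0r.
  by rewrite big_cons /F /=; ring.
apply: eq_bigr => a _; rewrite -mulr_sumr big_split /= -mulr_sumr.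
rewrite !sum_words_start /=; congr (_ * (_ + _)).
rewrite sum_option sum_words_None big_nil !mulr0 add0r.
apply: eq_bigr => y _; congr (_ * _).
by apply: eq_bigr => w _; rewrite mulrA.
Qed.

Lemma episode_prob_ge0 pi x w : is_policy pi -> 0 <= episode_prob M pi x w.
Proof.
move=> hpi; rewrite episode_probE mulr_ge0 //.
elim: w => [|[y a] w IH] //=.
by rewrite mulr_ge0 // mulr_ge0 //; [case: (hpi y)|exact: trans_ge0].
Qed.

(** Long words in [E] contribute nothing, so the unordered sum reduces to the finite list of short
    words. *)
Lemma esum_words n (F : episode S A -> R) (E : set (episode S A)) :
  (forall w, 0 <= F w) ->
  (forall w, (size w <= n)%N -> E w) ->
  (forall w, E w -> (n < size w)%N -> F w = 0) ->
  (\esum_(w in E) (F w)%:E)%E = (\sum_(w <- words (S * A)%type n) F w)%:E.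
Proof.
move=> F0 wE EF0.
transitivity (\esum_(w in [set` words (S * A)%type n]) (F w)%:E)%E.
  rewrite esum_mkcond [RHS]esum_mkcond; apply: eq_esum => w _.
  rewrite [w \in [set` _]](_ : _ = (size w <= n)%N); last first.
    by rewrite -mem_words; apply/idP/idP; rewrite inE.
  have [wn|wn] := leqP (size w) n; first by rewrite mem_set //; exact: wE.
  by case: ifPn => //; rewrite inE => Ew; rewrite EF0.
rewrite esum_fset; [|exact: finite_seq|by move=> w _; rewrite lee_fin].
by rewrite -fsbig_seq ?words_uniq // sumEFin.
Qed.

Lemma transient_mass Tbar pi x : transient M Tbar -> is_policy pi ->
  0 <= Tbar /\ mass pi (Num.truncn Tbar) (Some x) = 1.
Proof.
move=> hT hpi; have := hT pi x hpi; rewrite /episode_Pr.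
have [T0|T0] := leP 0 Tbar.
  rewrite (@esum_words (Num.truncn Tbar)) => [[m1]|w|w|w].
  - split=> //; rewrite -[RHS]m1.
    by apply: eq_bigr => w _; rewrite episode_probE.
  - exact: episode_prob_ge0.
  - by rewrite truncn_ge_nat.
  - by rewrite /= /hitting_time -truncn_ge_nat // ltnNge => ->.
(* For negative [Tbar] the event is empty and would have probability 0 instead of 1. *)
rewrite [X in \esum_(_ in X) _](_ : _ = set0) ?esum_set0.
  by move=> [] /eqP; rewrite eq_sym oner_eq0.
apply/seteqP; split=> w //= /le_lt_trans /(_ T0).
by rewrite ltNge ler0n.
Qed.

(** The defect is the probability of not stopping within the horizon. Its recursion has no source
    term, so both its sign and its vanishing propagate. *)
Lemma mass_defectS pi n x : is_policy pi ->
  1 - mass pi n.+1 (Some x) =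
  \sum_a pi x a * \sum_o trans M x a o * (1 - mass pi n o).
Proof.
move=> /(_ x)[_ pi1]; rewrite massS -[X in X - _]pi1 -sumrB.
apply: eq_bigr => a _.
under [in RHS]eq_bigr do rewrite mulrBr mulr1.
by rewrite sumrB trans_sum1 mulrBr mulr1.
Qed.

Lemma mass_le1 pi n o : is_policy pi -> mass pi n o <= 1.
Proof.
move=> hpi; elim: n o => [|n IH] [x|]; rewrite ?mass_None ?mass0 ?ler01 //.
rewrite -subr_ge0 mass_defectS // sumr_ge0 // => a _.
rewrite mulr_ge0 //; first by case: (hpi x).
by rewrite sumr_ge0 // => o _; rewrite mulr_ge0 ?trans_ge0 ?subr_ge0.
Qed.

(** The zero defect at [x] is a sum of nonnegative terms, so the term of the charged edge to [y]
    vanishes too. *)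
Lemma mass1_succ pi n x a y : is_policy pi -> 0 < pi x a ->
  trans M x a (Some y) != 0 ->
  mass pi n.+1 (Some x) = 1 -> mass pi n (Some y) = 1.
Proof.
move=> hpi pia ty m1; have := mass_defectS n x hpi; rewrite m1 subrr.
have t0 b o : 0 <= trans M x b o * (1 - mass pi n o).
  by rewrite mulr_ge0 ?trans_ge0 ?subr_ge0 ?mass_le1.
have s0 b : 0 <= pi x b * \sum_o trans M x b o * (1 - mass pi n o).
  by rewrite mulr_ge0 ?sumr_ge0 //; case: (hpi x).
move=> /esym /(psumr_eq0P (fun b _ => s0 b)) /(_ a isT) /eqP.
rewrite mulf_eq0 gt_eqF //= => /eqP /(psumr_eq0P (fun o _ => t0 a o)).
by move=> /(_ (Some y) isT) /eqP; rewrite mulf_eq0 (negbTE ty) subr_eq0 => /eqP.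
Qed.

(** * Ranks obtained from transience, and values as finite sums *)

Definition ranked (rk : S -> nat) : Prop :=
  (forall x, (0 < rk x)%N) /\
  forall x a y, trans M x a (Some y) != 0 -> (rk y < rk x)%N.

Lemma transient_ranked Tbar pi : transient M Tbar -> is_policy pi ->
  exists2 rk, ranked rk & forall x, (rk x)%:R <= Tbar.
Proof.
move=> hT hpi.
pose u (_ : S) (_ : A) : R := #|A|%:R^-1.
(* A distribution on an empty action set would sum to 0, so the given policy forces an action to
   exist and the uniform policy is well defined. *)
have A0 : (0 < #|A|)%N.
  rewrite lt0n; apply/negP => /eqP A0.
  have [_ /eqP] := hpi (init M); rewrite big1 ?(eq_sym 0) ?oner_eq0 //.
  by move=> a _; have := card0_eq A0 a; rewrite inE.
have u0 x a : 0 < u x a by rewrite invr_gt0 ltr0n.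
have hu : is_policy u.
  move=> x; split=> [a|]; first exact: ltW.
  by rewrite /u sumr_const -[LHS]mulr_natr mulVf // pnatr_eq0 -lt0n.
have ex x : exists n, mass u n (Some x) == 1.
  by exists (Num.truncn Tbar); case: (transient_mass x hT hu) => _ ->.
(* The rank is the least horizon within which the uniform policy stops with probability 1. *)
exists (fun x => ex_minn (ex x)); first split=> [x|x a y ty].
- case: ex_minnP => -[|//] /eqP; rewrite mass0 => /eqP.
  by rewrite eq_sym oner_eq0.
- case: ex_minnP => n /eqP ny nmin; case: ex_minnP => -[|m] /eqP mx _.
    by move/eqP: mx; rewrite mass0 eq_sym oner_eq0.
  by rewrite ltnS nmin //; apply/eqP; exact: mass1_succ (u0 x a) ty mx.
- move=> x; case: (transient_mass x hT hu) => T0 /eqP m1.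
  by case: ex_minnP => n _ /(_ _ m1); rewrite truncn_ge_nat.
Qed.

Lemma mass_ranked rk pi n x : ranked rk -> is_policy pi -> (rk x <= n)%N ->
  mass pi n (Some x) = 1.
Proof.
move=> [rk0 rkd] hpi; elim: n x => [|n IH] x rx.
  by have := leq_trans (rk0 x) rx.
apply/eqP; rewrite eq_sym -subr_eq0 mass_defectS // big1 // => a _.
rewrite big1 ?mulr0 // => -[y|] _; last by rewrite mass_None subrr mulr0.
have [->|/rkd ryx] := eqVneq (trans M x a (Some y)) 0; first by rewrite mul0r.
by rewrite IH ?subrr ?mulr0 // -ltnS (leq_trans ryx).
Qed.

(** Along an episode of positive probability the ranks strictly decrease and stay positive, which
    bounds its length by the first rank. *)
Lemma episode_prob_long rk pi x w : ranked rk -> (rk x < size w)%N ->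
  episode_prob M pi x w = 0.
Proof.
move=> [rk0 rkd]; rewrite episode_probE; elim: w x => [|[y a] w IH] x //=.
have [[->]|_] := eqVneq (Some y) (Some x); last by rewrite mul0r.
rewrite mul1r; case: w IH => [|[z b] w] IH rxw.
  by move: rxw; rewrite ltnS leqNgt rk0.
have [->|/rkd rzx] := eqVneq (trans M x a (Some z)) 0.
  by rewrite mulr0 mul0r.
have := IH z; rewrite [state_at _ _]/= eqxx mul1r => -> //.
  by rewrite mulr0.
by rewrite (leq_trans rzx).
Qed.

Lemma value_total rk pi h n x : ranked rk -> is_policy pi ->
  (forall y a, 0 <= h y a) -> (rk x <= n)%N ->
  value M pi h x = total h pi n (Some x).
Proof.
move=> hrk hpi h0 rx; rewrite /value /episode_E (@esum_words n) //=.
- by apply: eq_bigr => w _; rewrite episode_probE.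
- by move=> w; rewrite mulr_ge0 ?episode_prob_ge0 ?sumr_ge0.
- move=> w _ nw; rewrite (episode_prob_long _ hrk) ?mul0r //.
  exact: leq_ltn_trans nw.
Qed.

Lemma value_ge0 pi h x : is_policy pi -> (forall y a, 0 <= h y a) ->
  0 <= value M pi h x.
Proof.
move=> hpi h0; rewrite fine_ge0 // esum_ge0 // => w _.
by rewrite lee_fin mulr_ge0 ?episode_prob_ge0 ?sumr_ge0.
Qed.

Lemma value_bellman rk pi h x (V : option S -> R) :
  ranked rk -> is_policy pi -> (forall y a, 0 <= h y a) ->
  (forall y, V (Some y) = value M pi h y) ->
  value M pi h x = bellman M (pi x) h V x.
Proof.
move=> hrk hpi h0 VE; have [rk0 rkd] := hrk.
(* With horizon [rk x = n.+1], every reachable successor has rank at most [n]: its mass at horizon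
   [n] is 1 and its total is already its value. *)
rewrite (@value_total rk _ _ (rk x)) //.
case E : (rk x) (rk0 x) => [|n] // _; rewrite totalS.
apply: eq_bigr => a _; congr (_ * (_ + _)).
  rewrite -[RHS]mulr1 -(trans_sum1 M x a); congr (_ * _).
  apply: eq_bigr => -[y|] _; last by rewrite mass_None mulr1.
  have [->|/rkd ryx] := eqVneq (trans M x a (Some y)) 0; first by rewrite mul0r.
  by rewrite (mass_ranked hrk) ?mulr1 // -ltnS -E.
apply: eq_bigr => y _.
have [->|/rkd ryx] := eqVneq (trans M x a (Some y)) 0; first by rewrite !mul0r.
by rewrite VE (@value_total rk _ _ n) // -ltnS -E.
Qed.

End Episodes.

(** * Comparison principles and the safe Bellman operator on ranked models *)

Section Ranked.
Variables (R : realType) (S A : finType) (M : cmdp R S A) (rk : S -> nat).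
Hypothesis hrk : ranked M rk.
Implicit Types (pi : S -> A -> R) (x : S) (h : S -> A -> R) (p q : A -> R)
  (U V L : option S -> R).

(** The weights of the transient successors only sum to at most 1, the rest going to [None]; this is
    where the sign of [K] enters. *)
Lemma trans_sum_le x a (f : S -> R) K : 0 <= K ->
  (forall y, trans M x a (Some y) != 0 -> f y <= K) ->
  \sum_y trans M x a (Some y) * f y <= K.
Proof.
move=> K0 fK; apply: (@le_trans _ _ (\sum_y trans M x a (Some y) * K)).
  apply: ler_sum => y _; have [->|/fK fy] := eqVneq (trans M x a (Some y)) 0.
    by rewrite !mul0r.
  by rewrite ler_wpM2l ?trans_ge0.
rewrite -mulr_suml -[leRHS]mul1r ler_wpM2r // -(trans_sum1 M x a) sum_option.
by rewrite lerDr trans_ge0.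
Qed.

Lemma dist_sum_const p (K : R) : is_dist p -> \sum_a p a * K = K.
Proof. by case=> _ p1; rewrite -mulr_suml p1 mul1r. Qed.

Lemma bellman_mono p h U V x : is_dist p ->
  (forall a y, trans M x a (Some y) != 0 -> U (Some y) <= V (Some y)) ->
  bellman M p h U x <= bellman M p h V x.
Proof.
move=> [p0 _] UV; apply: ler_sum => a _; rewrite ler_wpM2l // lerD2l.
apply: ler_sum => y _; have [->|/UV ?] := eqVneq (trans M x a (Some y)) 0.
  by rewrite !mul0r.
by rewrite ler_wpM2l ?trans_ge0.
Qed.

(** The chain subsolution, monotonicity, supersolution closes by strong induction, since
    monotonicity at [x] compares [U] and [V] only at states of smaller rank. *)
Lemma bellman_compare pi h U V : is_policy pi ->
  (forall x, U (Some x) <= bellman M (pi x) h U x) ->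
  (forall x, bellman M (pi x) h V x <= V (Some x)) ->
  forall x, U (Some x) <= V (Some x).
Proof.
move=> hpi subU superV x.
have [n] := ubnP (rk x); elim: n x => // n IH x; rewrite ltnS => rx.
apply: le_trans (subU x) (le_trans _ (superV x)); apply: bellman_mono => //.
move=> a y /(proj2 hrk) ryx; apply: IH; exact: leq_trans ryx rx.
Qed.

Lemma value_le_super pi h V x : is_policy pi -> (forall y a, 0 <= h y a) ->
  (forall y, bellman M (pi y) h V y <= V (Some y)) ->
  value M pi h x <= V (Some x).
Proof.
move=> hpi h0 superV.
apply: (@bellman_compare pi h (oapp (value M pi h) 0)) => // y /=.
by rewrite (@value_bellman _ _ _ M rk _ _ _ (oapp (value M pi h) 0)).
Qed.

Lemma value_ge_sub pi h V x : is_policy pi -> (forall y a, 0 <= h y a) ->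
  (forall y, V (Some y) <= bellman M (pi y) h V y) ->
  V (Some x) <= value M pi h x.
Proof.
move=> hpi h0 subV.
apply: (@bellman_compare pi h V (oapp (value M pi h) 0)) => // y /=.
by rewrite (@value_bellman _ _ _ M rk _ _ _ (oapp (value M pi h) 0)).
Qed.

(** Each step loses at least one unit of rank, which pays for the extra cost of at most [K]; thus
    [K * rk] added to a supersolution absorbs the perturbation [k]. *)
Lemma bellman_rank_le p h (k : S -> A -> R) K V x : is_dist p -> 0 <= K ->
  (forall a, k x a <= K) ->
  bellman M p (fun y a => h y a + k y a) (fun z => V z + K * (oapp rk 0%N z)%:R) x
    <= bellman M p h V x + K * (rk x)%:R.
Proof.
move=> dp K0 kK; rewrite -[X in _ + X](dist_sum_const _ dp) -big_split /=.
apply: ler_sum => a _; rewrite -mulrDr ler_wpM2l //; first by case: dp.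
rewrite (eq_bigr (fun y => trans M x a (Some y) * V (Some y)
  + trans M x a (Some y) * (K * (rk y)%:R))); last by move=> y _; rewrite -mulrDr.
rewrite big_split /=.
have : \sum_y trans M x a (Some y) * (K * (rk y)%:R) <= K * (rk x).-1%:R.
  apply: trans_sum_le => //; first by rewrite mulr_ge0.
  move=> y /(proj2 hrk) ryx; rewrite ler_wpM2l // ler_nat.
  by rewrite -ltnS prednK // (proj1 hrk).
have -> : (rk x)%:R = (rk x).-1%:R + 1 :> R.
  by rewrite natr1 prednK // (proj1 hrk).
by have := kK a; lra.
Qed.

Lemma value_add_le pi h (k : S -> A -> R) K x : is_policy pi ->
  (forall y a, 0 <= h y a) -> (forall y a, 0 <= k y a <= K) ->
  value M pi (fun y a => h y a + k y a) x <= value M pi h x + K * (rk x)%:R.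
Proof.
move=> hpi h0 k0K.
have K0 : 0 <= K.
  have [a _|A0] := pickP (fun _ : A => true).
    by case/andP: (k0K x a) => /le_trans; apply.
  by have [_ /eqP] := hpi x; rewrite big_pred0 // eq_sym oner_eq0.
pose V z : R := oapp (value M pi h) 0 z + K * (oapp rk 0%N z)%:R.
apply: (@value_le_super pi _ V) => // [y a|y].
  by rewrite addr_ge0 //; case/andP: (k0K y a).
apply: le_trans (bellman_rank_le _ _ (hpi y) K0 _) _.
  by move=> a; case/andP: (k0K y a).
by rewrite /V /= lerD2r -(@value_bellman _ _ _ M rk).
Qed.

Lemma value_le pi h K x : is_policy pi -> (forall y a, 0 <= h y a <= K) ->
  value M pi h x <= K * (rk x)%:R.
Proof.
move=> hpi hK; have h0 y a : 0 <= h y a by case/andP: (hK y a).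
have := @value_add_le pi (fun _ _ => 0) h K x hpi (fun _ _ => lexx 0) hK.
have -> : (fun y a => 0 + h y a) = h.
  by apply/funext => y; apply/funext => a; rewrite add0r.
move=> /le_trans; apply; rewrite gerDr.
apply: (@value_le_super pi (fun _ _ => 0) (fun=> 0)) => // y.
rewrite /bellman big1 // => a _; rewrite add0r big1 ?mulr0 // => z _.
by rewrite mulr0.
Qed.

Lemma bellman_state_cost p (f : S -> R) V x : is_dist p ->
  bellman M p (fun y _ => f y) V x =
  f x + \sum_a p a * \sum_y trans M x a (Some y) * V (Some y).
Proof.
move=> dp; rewrite -[X in X + _](dist_sum_const _ dp) -big_split.
by apply: eq_bigr => a _; rewrite mulrDr.
Qed.

(** The state cost is the same under both distributions; the expected continuation of each action
    lies in [[0, K]] and is weighted by [p a - q a]. The factor 2 cancels the half in [dTV]. *)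
Lemma bellman_dTV_le p q (f : S -> R) V K x : is_dist p -> is_dist q ->
  0 <= K -> (forall y, 0 <= V (Some y) <= K) ->
  bellman M p (fun y _ => f y) V x <=
  bellman M q (fun y _ => f y) V x + 2 * K * dTV p q.
Proof.
move=> dp dq K0 VK; rewrite !bellman_state_cost //.
rewrite -addrA lerD2l -lerBlDl -sumrB /dTV.
rewrite [leRHS](_ : _ = K * \sum_a `|q a - p a|); last by field.
rewrite mulr_sumr.
apply: ler_sum => a _; rewrite -mulrBl.
have : 0 <= \sum_y trans M x a (Some y) * V (Some y).
  by apply: sumr_ge0 => y _; rewrite mulr_ge0 ?trans_ge0 //; case/andP: (VK y).
have : \sum_y trans M x a (Some y) * V (Some y) <= K.
  by apply: trans_sum_le => // y _; case/andP: (VK y).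
set s := \sum_y _ => sK s0; rewrite distrC mulrC.
apply: (@le_trans _ _ (s * `|p a - q a|)); first by rewrite ler_wpM2l // ler_norm.
by rewrite ler_wpM2r.
Qed.

Lemma safe_bellman_ext L V V' x :
  (forall a y, trans M x a (Some y) != 0 -> V (Some y) = V' (Some y)) ->
  safe_bellman M L V (Some x) = safe_bellman M L V' (Some x).
Proof.
move=> VV'; congr (inf _); apply: eq_imagel => p _.
apply: eq_bigr => a _; congr (_ * (_ + _)); apply: eq_bigr => y _.
have [->|/VV' -> //] := eqVneq (trans M x a (Some y)) 0.
by rewrite !mul0r.
Qed.

(** By induction on [n]: the iterates at the successors of [x], which have smaller rank, have
    stabilized one iteration earlier. *)
Lemma safe_bellman_iter L V n x : (rk x <= n)%N ->
  iter n.+1 (safe_bellman M L) V (Some x) = iter n (safe_bellman M L) V (Some x).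
Proof.
elim: n x => [|n IH] x rx; first by have := leq_trans (proj1 hrk x) rx.
rewrite !iterS; apply: safe_bellman_ext => a y /(proj2 hrk) ryx.
by apply: IH; rewrite -ltnS (leq_trans ryx).
Qed.

Lemma safe_bellman_fixpoint L :
  exists! V, forall z, safe_bellman M L V z = V z.
Proof.
pose N := \max_x rk x.
(* [N] iterations stabilize every transient state; the successor form makes the value at [None]
   reduce to 0. *)
exists (iter N.+1 (safe_bellman M L) (fun=> 0)); split=> [[x|] //|V' V'fix].
  rewrite -iterS safe_bellman_iter // ltnW // ltnS.
  by rewrite (leq_bigmax x).
apply/funext => -[x|]; last by rewrite -V'fix.
set V := iter _ _ _.
have Vfix y : safe_bellman M L V (Some y) = V (Some y).
  rewrite /V -iterS safe_bellman_iter // ltnW // ltnS.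
  by rewrite (leq_bigmax y).
have [n] := ubnP (rk x); elim: n x => // n IH x; rewrite ltnS => rx.
rewrite -V'fix -Vfix; apply: safe_bellman_ext => a y /(proj2 hrk) ryx.
by apply: IH; exact: leq_trans ryx rx.
Qed.

End Ranked.

(** * Existence of greedy policies and attainment of the infimum *)

Section Greedy.
Variables (R : realType) (S A : finType) (M : cmdp R S A).
Implicit Types (pi : S -> A -> R) (L V : option S -> R).

Lemma greedy_exists L V : (forall x, Defs.induced M L x !=set0) ->
  exists pi, greedy M L V pi.
Proof.
move=> ne; suff /choice[pi hpi] : forall x, exists p, Defs.induced M L x p /\
    forall q, Defs.induced M L x q ->
      bellman M p (cost M) V x <= bellman M q (cost M) V x.
  by exists pi.
move=> x; have [p [dp pL pmin]] := simplex_halfspace_argmin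
  (fun a => cost M x a + \sum_y trans M x a (Some y) * V (Some y)) (ne x).
by exists p; split=> // q [dq qL]; exact: pmin.
Qed.

(** The greedy distribution witnesses that the set under [inf] is nonempty and bounded below, so the
    infimum is a true minimum. *)
Lemma greedy_safe_bellman L V pi x : greedy M L V pi ->
  safe_bellman M L V (Some x) = bellman M (pi x) (cost M) V x.
Proof.
move=> /(_ x)[piL pimin]; rewrite /safe_bellman.
have lb : lbound [set bellman M p (cost M) V x | p in Defs.induced M L x]
    (bellman M (pi x) (cost M) V x) by move=> _ [q /pimin qb <-].
apply/eqP; rewrite eq_le; apply/andP; split.
  by apply: ge_inf; [exists (bellman M (pi x) (cost M) V x)|exists (pi x)].
by apply: lb_le_inf => //; exists (bellman M (pi x) (cost M) V x), (pi x).
Qed.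

End Greedy.

(** * The Lyapunov function of the baseline and optimality of the fixed point *)

Theorem theorem2 (R : realType) (S A : finType) (M : cmdp R S A) (Tbar : R)
    (piB pistar : S -> A -> R)
    (hT : transient M Tbar)
    (hB : feasible M piB)
    (hstar : optimal M pistar)
    (heps : max_state M (eps_star M Tbar pistar piB) <=
      Dmax M * Num.min
        ((threshold M - ccost_value M piB (init M)) / (Tbar * Dmax M))
        ((Tbar * Dmax M - Dbar M) / (Tbar * Dmax M + Dbar M))) :
  let L := lyapunov M Tbar pistar piB in
  (exists! V : option S -> R, forall z, safe_bellman M L V z = V z) /\
  forall V : option S -> R, (forall z, safe_bellman M L V z = V z) ->
    [/\ is_min [set cost_value M pi (init M) | pi in [set pi | feasible M pi]]
          (V (Some (init M))),
        exists pi, greedy M L V pi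
      & forall pi, greedy M L V pi -> optimal M pi].
Proof.
move=> L; have [hpB B_feas] := hB; have [[hps s_feas] s_opt] := hstar.
have [rk hrk rkT] := transient_ranked hT hpB.
have D0 := Dmax_gt0 M.
have T0 : 0 < Tbar.
  by apply: lt_le_trans _ (rkT (init M)); rewrite ltr0n (proj1 hrk).
have TD0 : 0 < Tbar * Dmax M by rewrite mulr_gt0.
have d0 y (_ : A) : 0 <= ccost M y by case/andP: (ccost_bounds M y).
have dD y (_ : A) : 0 <= ccost M y <= Dmax M := ccost_bounds M y.
have c0 y a : 0 <= cost M y a by case/andP: (cost_bounds M y a).
have le_Tbar K x : 0 <= K -> K * (rk x)%:R <= Tbar * K.
  by move=> K0; rewrite mulrC ler_wpM2r.
have ccost_le pi x : is_policy pi -> ccost_value M pi x <= Tbar * Dmax M.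
  move=> hpi; apply: le_trans (value_le hrk x hpi dD) _.
  by apply: le_Tbar; exact: ltW.
have le_max (f : S -> R) x : f x <= max_state M f by exact: le_bigmax.
(* The supremum in [Dbar] bounds the constraint values only once this set is known to be bounded
   above. *)
pose E x := [set ccost_value M pi x | pi in [set pi | is_policy pi]].
have ubE x : ubound (E x) (Tbar * Dmax M).
  by move=> _ [pi hpi <-]; exact: ccost_le.
have Dbar_le : Dbar M <= Tbar * Dmax M.
  have supE x : sup (E x) <= Tbar * Dmax M.
    by apply: ge_sup => //; exists (ccost_value M piB x), piB.
  by apply: bigmax_le => [|x _]; exact: supE.
have le_Dbar x : ccost_value M piB x <= Dbar M.
  apply: le_trans (le_max (fun x => sup (E x)) x).
  by apply: ub_le_sup; [exists (Tbar * Dmax M)|exists piB].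
have B0 : 0 <= ccost_value M piB (init M) by exact: value_ge0.
have Dbar0 : 0 <= Dbar M by exact: le_trans (le_Dbar (init M)).
set eps := eps_star M Tbar pistar piB in heps.
set e := max_state M eps in heps.
have eps0 x : 0 <= eps x.
  rewrite /eps /eps_star /dTV !mulr_ge0 ?invr_ge0 ?(ltW T0) ?(ltW D0) //.
  exact: sumr_ge0.
have epse y (_ : A) : 0 <= eps y <= e by rewrite eps0 le_max.
have e0 : 0 <= e := le_trans (eps0 (init M)) (le_max eps _).
(* Distributing [Dmax M] over the minimum yields one bound on [e] for feasibility at the initial
   state and one for the size of [L]. *)
move: heps; rewrite minr_pMr ?(ltW D0) // le_min => /andP[he1 he2].
have LE x : L (Some x) = value M piB (fun y _ => ccost M y + eps y) x by [].
have L_le x : L (Some x) <= ccost_value M piB x + Tbar * e.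
  apply: le_trans (value_add_le hrk x hpB d0 epse) _.
  by rewrite lerD2l le_Tbar.
have L0 x : 0 <= L (Some x).
  by rewrite LE value_ge0 // => y a; rewrite addr_ge0 // (d0 y a).
have LTD x : 0 <= L (Some x) <= Tbar * Dmax M.
  rewrite L0 /=; apply: le_trans (L_le x) _.
  apply: le_trans (lerD (le_Dbar x) (lexx _)) _.
  (* Write [K] for [Tbar * Dmax M] and [D] for [Dbar M]. The bound [D + K * (K - D) / (K + D) <= K],
     cleared of its denominator, amounts to [D * D <= D * K]. *)
  have W0 : 0 < Tbar * Dmax M + Dbar M by rewrite ltr_pwDl.
  rewrite mulrA ler_pdivlMr // -(ler_pM2l T0) in he2.
  rewrite -(ler_pM2r W0); have := ler_wpM2l Dbar0 Dbar_le; lra.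
have L_init : L (Some (init M)) <= threshold M.
  apply: le_trans (L_le _) _.
  rewrite mulrA ler_pdivlMr // in he1.
  by rewrite -lerBrDl -(ler_pM2l D0); lra.
have star_induced x : Defs.induced M L x (pistar x).
  split=> //; apply: le_trans
    (bellman_dTV_le M (ccost M) x (hps x) (hpB x) (ltW TD0) LTD) _.
  (* The total variation error is [eps x] by definition; added to the constraint cost it gives the
     right-hand side of the Bellman equation of [L] under [piB]. *)
  rewrite LE (@value_bellman _ _ _ M rk _ _ _ L) //; last first.
    by move=> y a; rewrite addr_ge0 // (d0 y a).
  rewrite !bellman_state_cost // -/eps /eps /eps_star.
  lra.
have feas pi : (forall x, Defs.induced M L x (pi x)) -> feasible M pi.
  move=> hpi; have pol : is_policy pi by move=> x; case: (hpi x).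
  split=> //; apply: le_trans L_init.
  by apply: (value_le_super hrk) => // x; case: (hpi x).
split=> [|V Vfix]; first exact: (safe_bellman_fixpoint hrk).
have V_greedy pi : greedy M L V pi ->
    feasible M pi /\ cost_value M pi (init M) = V (Some (init M)).
  move=> g; have fpi : feasible M pi by apply: feas => x; case: (g x).
  have VE x : V (Some x) = bellman M (pi x) (cost M) V x.
    by rewrite -Vfix; exact: greedy_safe_bellman.
  (* [V] solves the cost Bellman equation of [pi] exactly, so it is both a supersolution and a
     subsolution. *)
  split=> //; apply/eqP; rewrite eq_le; apply/andP; case: fpi => hpi _; split.
    by apply: (value_le_super hrk) => // x; rewrite -VE.
  by apply: (value_ge_sub hrk) => // x; rewrite -VE.
have [pi0 g0] : exists pi, greedy M L V pi.
  by apply: greedy_exists => x; exists (pistar x).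
have V_le pi : feasible M pi -> V (Some (init M)) <= cost_value M pi (init M).
  (* A feasible [pi] need not be induced, so the comparison passes through [pistar], which is:
     minimality over induced distributions makes [V] a subsolution for [pistar]. *)
  move=> /s_opt; apply: le_trans; apply: (value_ge_sub hrk) => // x.
  rewrite -[leLHS]Vfix (greedy_safe_bellman x g0).
  by case: (g0 x) => _; apply.
split; [split|by exists pi0|].
- by have [? <-] := V_greedy pi0 g0; exists pi0.
- by move=> _ [pi fpi <-]; exact: V_le.
- by move=> pi /V_greedy[fpi Vpi]; split=> // pi' fpi'; rewrite Vpi V_le.
Qed.
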